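(* Let $m \neq 1$ be a squarefree integer, let $K = \mathbb{Q}(\sqrt{m}\,)$, let $D_m$ be the ring of integers of $K$, and let $\Delta$ be the discriminant of $K$. Put $\mu_m = \sqrt{-\Delta/3}$ if $m < 0$ and $\mu_m = \sqrt{\Delta/5}$ if $m > 0$. Assume that for every rational prime $p$ with $2 \le p \le \mu_m$ and $\left(\frac{\Delta}{p}\right) \ne -1$ there is an element $\pi \in D_m$ with $p = |N\pi|$. Then $D_m$ is a principal ideal domain.
   Context: $N$ denotes the norm from $K$ to $\mathbb{Q}$. The discriminant is $\Delta = m$ if $m \equiv 1 \bmod 4$ and $\Delta = 4m$ if $m \equiv 2, 3 \bmod 4$. The symbol $\left(\frac{\Delta}{p}\right)$ is the Kronecker symbol: for odd primes $p$ it is the Legendre symbol (equal to $0$ if $p \mid \Delta$), and for $p = 2$ it equals $0$ if $\Delta$ is even, $+1$ if $\Delta \equiv 1 \bmod 8$, and $-1$ if $\Delta \equiv 5 \bmod 8$. *)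

(* Defs.v *)
From HB Require Import structures.
From mathcomp Require Import all_boot all_order all_algebra all_fingroup all_field.
From mathcomp Require Import boolp.

Set Implicit Arguments.
Unset Strict Implicit.
Unset Printing Implicit Defensive.

Import Order.TTheory GRing.Theory Num.Theory.
Local Open Scope ring_scope.

(* Excludes 0, since 2 ^+ 2 divides 0. *)
Definition squarefree (m : int) : Prop :=
  forall d : int, (d ^+ 2 %| m)%Z -> `|d| = 1.

Definition disc (m : int) : int :=
  if (m %% 4)%Z == 1 then m else 4 * m.

(* The Kronecker symbol (D / p), only meaningful for p prime and for D = 0 or
   1 modulo 4, as every discriminant is: then an odd D is 1 or 5 modulo 8. *)
Definition kronecker (D : int) (p : nat) : int :=
  if (p %| D)%Z then 0
  else if p == 2%N then (if (D %% 8)%Z == 1 then 1 else -1)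
  else if [exists x : 'F_p, x ^+ 2 == D%:~R] then 1 else -1.

Definition mu (m : int) : algR :=
  if m < 0 then Num.sqrt ((- disc m)%:~R / 3) else Num.sqrt ((disc m)%:~R / 5).

Definition integral_pred (K : fieldType) : pred K :=
  fun x => `[< integralOver (intr : int -> K) x >].

Lemma integral_pred_subring (K : fieldType) : subring_closed (@integral_pred K).
Proof.
split=> [|x y /asboolP Zx /asboolP Zy|x y /asboolP Zx /asboolP Zy];
  apply/asboolP.
- exact: (integral1 (intr : {rmorphism int -> K})).
- exact: (@integral_sub _ _ (intr : {rmorphism int -> K})).
- exact: (@integral_mul _ _ (intr : {rmorphism int -> K})).
Qed.

HB.instance Definition _ (K : fieldType) :=
  GRing.isSubringClosed.Build K (@integral_pred K)
    (@integral_pred_subring K).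

Record ringOfIntegers (K : fieldType) : predArgType :=
  RingOfIntegers { int_val :> K; _ : int_val \in @integral_pred K }.

HB.instance Definition _ (K : fieldType) := [isSub for @int_val K].
HB.instance Definition _ (K : fieldType) :=
  [Choice of ringOfIntegers K by <:].
HB.instance Definition _ (K : fieldType) :=
  [SubChoice_isSubComNzRing of ringOfIntegers K by <:].

Definition is_ideal (R : comNzRingType) (I : R -> Prop) : Prop :=
  [/\ I 0, forall x y, I x -> I y -> I (x + y) & forall a x, I x -> I (a * x)].

Definition is_PID (R : comNzRingType) : Prop :=
  GRing.integral_domain_axiom R /\
  forall I : R -> Prop, is_ideal I ->
    exists a : R, forall x : R, I x <-> exists r : R, x = r * a.

(* Main.v *)
Require Import Defs.
From mathcomp Require Import all_boot all_order all_algebra all_fingroup all_field.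
From mathcomp Require Import boolp ring lra zify.

Set Implicit Arguments.
Unset Strict Implicit.
Unset Printing Implicit Defensive.

Import Order.TTheory GRing.Theory Num.Theory.
Local Open Scope ring_scope.

(* Write D_m = Z + Zw with w^2 = tw - n, so that disc m = t^2 - 4n. In a nonzero
   ideal I choose g <> 0 with |N g| minimal and put J = g^-1 I. Then J contains
   D_m and its nonzero elements have |norm| >= 1, so that the rationals in J are
   integers. If J were larger than D_m, it would contain some (w - u) / p with p
   prime and u an integer. The norms of its translates by integers are
   ((2u - t + 2pk)^2 - disc m) / 4p^2; as none of them lies in ]-1, 1[, p is at
   most mu_m. Moreover N(w - u) / p lies in J, so p divides N(w - u) and
   (disc m / p) <> -1. Hence p = |N pi| for some pi, and either pi / p or its
   conjugate lies in J, although its norm is 1/p in absolute value. *)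

(** * Submodules over Z[w] whose nonzero norms are at least 1 *)

Lemma min_residue_bound (D w : int) (p : nat) : (0 < p)%N ->
  (forall k : int, 4 * p%:Z ^+ 2 <= `|(w + 2 * p%:Z * k) ^+ 2 - D|) ->
  if D < 0 then 3 * p%:Z ^+ 2 <= - D else 5 * p%:Z ^+ 2 <= D.
Proof.
move=> p_gt0 far.
have [k [lo hi]] : exists k : int,
    - p%:Z <= w + 2 * p%:Z * k /\ w + 2 * p%:Z * k <= p%:Z.
  exists (- ((w + p%:Z) %/ (2 * p%:Z))%Z).
  have := divz_eq (w + p%:Z) (2 * p%:Z).
  have := ltz_pmod (w + p%:Z) (_ : 0 < 2 * p%:Z).
  have := modz_ge0 (w + p%:Z) (_ : 2 * p%:Z != 0).
  by move=> /(_ ltac:(lia)) ? /(_ ltac:(lia)) ?; lia.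
(* Let v be the representative in [-p, p]. If D < 0, then v^2 - D >= 4p^2 already gives the bound.
   Otherwise v forces D >= 4p^2, and whichever of v + 2p, v - 2p has absolute value r in [p, 2p]
   forces D >= r^2 + 4p^2 >= 5p^2. *)
have far0 := far k; have far1 := far (k + 1); have far2 := far (k - 1).
move: far0 far1 far2.
rewrite !mulrDr mulrN !addrA !mulr1; move: (w + _) lo hi => v lo hi.
case: ifP => D0 f0 f1 f2; first by nia.
case: (lerP 0 v) => v0; nia.
Qed.

(** The norm of x + y w, where w^2 = t w - n. *)
Definition qnorm (t n : int) (x y : rat) : rat :=
  x ^+ 2 + t%:~R * x * y + n%:~R * y ^+ 2.

(* Elements x + y w of K are given by their coordinates; J is a submodule of K
   over Z[w] that contains Z[w]. *)
Section Overmodule.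

Variables (t n : int) (J : rat -> rat -> Prop).
Let D : int := t ^+ 2 - 4 * n.
Hypothesis JD : forall x y x' y', J x y -> J x' y' -> J (x + x') (y + y').
Hypothesis JZ : forall (a : int) x y, J x y -> J (a%:~R * x) (a%:~R * y).
Hypothesis Jw : forall x y, J x y -> J (- n%:~R * y) (x + t%:~R * y).
Hypothesis J1 : J 1 0.
Hypothesis J_norm : forall x y, J x y -> (x != 0) || (y != 0) ->
  1 <= `|qnorm t n x y|.

(** The fractional part of x also lies in J, and its norm is its square, which is less than 1. *)
Lemma overmodule_rat x : J x 0 -> x \is a Num.int.
Proof.
move=> Jx; have /andP[lo hi] := floor_itv x.
have Jfrac : J (x - (Num.floor x)%:~R) 0.
  by have := JD Jx (JZ (- Num.floor x) J1); rewrite rmorphN mulr0 mulr1 addr0.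
have [/eqP|frac_neq0] := eqVneq (x - (Num.floor x)%:~R) 0.
  by rewrite subr_eq0 => /eqP ->.
have := J_norm Jfrac; rewrite frac_neq0 /qnorm => /(_ isT).
have r_ge0 : 0 <= x - (Num.floor x)%:~R by rewrite subr_ge0.
have r_lt1 : x - (Num.floor x)%:~R < 1 by rewrite ltrBlDl; move: hi; rewrite rmorphD.
rewrite mulr0 expr0n /= mulr0 !addr0 ger0_norm ?exprn_ge0 //.
by rewrite leNgt expr_lt1 // r_lt1.
Qed.

Lemma overmodule_w : J 0 1.
Proof. by have := Jw J1; rewrite !mulr0 addr0. Qed.

Lemma overmodule_int x y : J x y -> y \is a Num.int -> x \is a Num.int.
Proof.
move=> Jxy /intrP[b y_def]; apply: overmodule_rat.
have := JD Jxy (JZ (- b) overmodule_w).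
by rewrite y_def rmorphN mulr0 mulr1 addr0 subrr.
Qed.

Lemma overmodule_prime x y : J x y -> y \isn't a Num.int ->
  exists (p : nat) (u : int), prime p /\ J (- u%:~R / p%:R) p%:R^-1.
Proof.
move=> Jxy; rewrite Qint_def => den_neq1.
have den_gt0 := denq_gt0 y.
have den_gt1 : (1 < `|denq y|)%N by lia.
pose p := pdiv `|denq y|; have p_pr : prime p by apply: pdiv_prime.
have [q den_def] : exists q : int, denq y = q * p%:Z.
  by apply/dvdzP; rewrite dvdzE /= pdiv_dvd.
have p_neq0 : p%:R != 0 :> rat by rewrite pnatr_eq0; case: (p) p_pr.
(* Since p divides the denominator of y, it is prime to the numerator. A Bezout relation turns a
   multiple of the element, plus a multiple of w, into one with w-coordinate exactly 1/p. *)
have [[a b] /= ab1] : exists ab : int * int, ab.1 * numq y + ab.2 * p%:Z = 1.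
  apply/coprimezP; rewrite coprimezE /=.
  by apply: coprime_dvdr (pdiv_dvd _) (coprime_num_den y).
have qy : q%:~R * y = (numq y)%:~R / p%:R.
  rewrite -{1}(divq_num_den y) den_def rmorphM /= -pmulrn.
  have q_neq0 : q%:~R != 0 :> rat.
    by rewrite intr_eq0; apply: contraTneq den_gt0 => q0; rewrite den_def q0 mul0r.
  by field; rewrite p_neq0 q_neq0.
have := JD (JZ (a * q) Jxy) (JZ b overmodule_w).
rewrite mulr0 mulr1 addr0; set x' := _ * x.
have -> : (a * q)%:~R * y + b%:~R = p%:R^-1.
  rewrite rmorphM /= -mulrA qy -(mulfK p_neq0 b%:~R) mulrA -mulrDl.
  by rewrite pmulrn -!rmorphM -rmorphD /= ab1 mul1r.
move=> Jtau; exists p.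
(* Multiplying by p makes the w-coordinate 1, so the rational coordinate becomes an integer. *)
have /intrP[v v_def] : p%:R * x' \is a Num.int.
  apply: overmodule_int (JZ p Jtau) _.
  by rewrite -pmulrn mulfV.
exists (- v); split=> //.
have -> : - (- v)%:~R = p%:R * x' by rewrite pmulrn v_def rmorphN opprK.
by rewrite mulrC mulKf.
Qed.

(** A root u of X^2 - t X + n modulo p replaces the condition on the Kronecker symbol, and the
    inequality is p <= mu without square roots. *)
Hypothesis small_primes_norms : forall p : nat, prime p ->
  (if D < 0 then 3 * p%:Z ^+ 2 <= - D else 5 * p%:Z ^+ 2 <= D) ->
  (exists u : int, (p%:Z %| u ^+ 2 - t * u + n)%Z) ->
  exists a b : int, `|qnorm t n a%:~R b%:~R| = p%:R.

Lemma overmodule_trivial x y : J x y ->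
  x \is a Num.int /\ y \is a Num.int.
Proof.
move=> Jxy.
suff y_int : y \is a Num.int by split=> //; apply: overmodule_int y_int.
apply: contraT => /(overmodule_prime Jxy)[p [u [p_pr Jtau]]].
have p_gt0 := prime_gt0 p_pr; have p_gt1 := prime_gt1 p_pr.
have p_neq0 : p%:R != 0 :> rat by rewrite pnatr_eq0 -lt0n.
have pV_neq0 : p%:R^-1 != 0 :> rat by rewrite invr_eq0.
(* (conj(w) - u) * (w - u) / p = N(w - u) / p is rational, hence an integer. *)
have [k k_def] : exists k : int, u ^+ 2 - t * u + n = k * p%:Z.
  have := JD (Jw Jtau) (JZ (u - t) Jtau).
  have -> : (- u%:~R / p%:R + t%:~R / p%:R + (u - t)%:~R / p%:R) = 0 :> rat.
    by rewrite rmorphB /=; field.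
  move=> /overmodule_rat/intrP[k k_def]; exists (- k).
  apply: (@intr_inj rat); rewrite mulNr rmorphN rmorphM /= -k_def -pmulrn.
  by rewrite rmorphD rmorphB rmorphXn !rmorphM /= rmorphB /=; field.
have bound : if D < 0 then 3 * p%:Z ^+ 2 <= - D else 5 * p%:Z ^+ 2 <= D.
  apply: (@min_residue_bound _ (2 * u - t)) => // l.
  have := J_norm (JD Jtau (JZ (- l) J1)).
  rewrite mulr0 mulr1 addr0 pV_neq0 orbT => /(_ isT).
  have -> : qnorm t n (- u%:~R / p%:R + (- l)%:~R) p%:R^-1 =
     ((2 * u - t + 2 * p%:Z * l) ^+ 2 - D)%:~R / (4 * p%:R ^+ 2).
    rewrite /qnorm /D !(rmorphXn,rmorphM,rmorphB,rmorphD,rmorphN) /= -pmulrn.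
    by field.
  rewrite normrM normfV ler_pdivlMr ?normr_gt0 ?mulf_neq0 ?expf_neq0 // mul1r.
  rewrite [X in X <= _]ger0_norm ?mulr_ge0 ?exprn_ge0 //.
  rewrite -(ler_int rat) intr_norm; apply: le_trans.
  by rewrite rmorphM rmorphXn /= -pmulrn.
have [|a [b ab_norm]] := small_primes_norms p_pr bound.
  by exists u; apply/dvdzP; exists k.
have no_inv : forall c e : rat, J c e -> `|qnorm t n c e| = p%:R^-1 -> false.
  move=> c e Jce ce_norm.
  have : 1 <= p%:R^-1 :> rat.
    rewrite -ce_norm; apply: J_norm Jce _.
    apply: contraT; rewrite negb_or !negbK => /andP[/eqP c0 /eqP e0].
    have q0 : qnorm t n 0 0 = 0 by rewrite /qnorm; ring.
    by move: ce_norm pV_neq0; rewrite c0 e0 q0 normr0 => <-; rewrite eqxx.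
  by rewrite invf_ge1 ?ltr0n // lern1 leqNgt p_gt1.
(* The two factors tell whether pi or its conjugate lies in (p, w - u). *)
have : (p%:Z %| (a + b * u) * (a + b * (t - u)))%Z.
  pose e := a ^+ 2 + t * a * b + n * b ^+ 2.
  have e_p : (p%:Z %| e)%Z.
    have : `|e%:~R| = p%:R :> rat.
      by rewrite -ab_norm /qnorm !(rmorphD, rmorphM, rmorphXn).
    rewrite -intr_norm pmulrn => /intr_inj norm_e.
    by rewrite dvdzE; have -> : `|e|%N = p by lia.
  (* The product differs from N(a + b w) = e by b^2 N(w - u), and p divides both. *)
  have -> : (a + b * u) * (a + b * (t - u)) = e - b ^+ 2 * k * p%:Z.
    by rewrite -mulrA -k_def /e; ring.
  by rewrite rpredB // dvdz_mull.
rewrite dvdzE abszM Euclid_dvdM // -!dvdzE.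
have norm_div x' y' : qnorm t n x' y' = qnorm t n a%:~R b%:~R ->
    `|qnorm t n (x' / p%:R) (y' / p%:R)| = p%:R^-1.
  move=> eq_ab.
  have -> : qnorm t n (x' / p%:R) (y' / p%:R) = qnorm t n x' y' / p%:R ^+ 2.
    by rewrite /qnorm; field.
  rewrite eq_ab normrM ab_norm normfV [`|_ ^+ 2|]ger0_norm ?exprn_ge0 //.
  by field.
(* If p divides a + b u, then (a + b w) / p = b (w - u) / p + (a + b u) / p lies in J. *)
case/orP=> /dvdzP[f /(congr1 (intr : int -> rat))].
  rewrite !rmorphD !rmorphM /= -pmulrn => f_def.
  apply: (no_inv (a%:~R / p%:R) (b%:~R / p%:R)); last exact: norm_div.
  have := JD (JZ b Jtau) (JZ f J1); congr J; last by rewrite mulr0 addr0.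
  by rewrite mulr1 -[f%:~R](mulfK p_neq0) -f_def; field.
(* Otherwise the conjugate a + b t - b w is used: divided by p, it is -b (w - u) / p + (a + b (t -
   u)) / p. *)
rewrite rmorphD rmorphM rmorphB /= rmorphM /= -pmulrn => f_def.
apply: (no_inv ((a%:~R + b%:~R * t%:~R) / p%:R) (- b%:~R / p%:R)).
  have := JD (JZ (- b) Jtau) (JZ f J1); rewrite rmorphN.
  congr J; last by rewrite mulr0 addr0.
  by rewrite mulr1 -[f%:~R](mulfK p_neq0) -f_def; field.
by apply: norm_div; rewrite /qnorm; ring.
Qed.

End Overmodule.

(** * Squarefree integers, rational integral elements and parity *)

Lemma rat_int_of_sqr_mul (m : int) (r : rat) : squarefree m ->
  r ^+ 2 * m%:~R \is a Num.int -> r \is a Num.int.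
Proof.
move=> m_sqf /intrP[c]; rewrite -{1}(divq_num_den r) => c_def.
have den_neq0 : (denq r)%:~R != 0 :> rat by rewrite intr_eq0 denq_neq0.
have num_eq : numq r ^+ 2 * m = c * denq r ^+ 2.
  apply: (@intr_inj rat); rewrite !(rmorphM, rmorphXn) /= -c_def.
  by field.
(* The squared denominator divides [numq r ^+ 2 * m] and is prime to [numq r ^+ 2]. *)
have den_dvd : (denq r ^+ 2 %| m)%Z.
  rewrite -(@Gauss_dvdzr _ (numq r ^+ 2)); first by rewrite num_eq dvdz_mull.
  by rewrite coprimezXl ?coprimezXr // coprimez_sym coprimezE coprime_num_den.
by rewrite Qint_def -(gtr0_norm (denq_gt0 r)) (m_sqf _ den_dvd).
Qed.

Lemma squarefree_not_rat_square (m : int) (r : rat) :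
  squarefree m -> m != 1 -> r ^+ 2 != m%:~R.
Proof.
move=> m_sqf; apply: contraNneq => r2.
have /intrP[z z_def] : r \is a Num.int.
  apply: (@rat_int_of_sqr_mul 1).
    move=> d; rewrite dvdz1 abszX => /eqP d2.
    by apply/eqP; rewrite -abszE; move: d2; case: `|d|%N => [|[|]].
  by rewrite mulr1 r2 intr_int.
have m_def : m = z ^+ 2.
  by apply: (@intr_inj rat); rewrite -r2 z_def rmorphXn.
by rewrite m_def -real_normK ?num_real // m_sqf ?expr1n // m_def.
Qed.

(** The monic equation is carried over to [algC], where a rational algebraic integer is an
    integer. *)
Lemma rat_integral_int (K : fieldExtType rat) (r : rat) :
  integralOver (intr : int -> K) r%:A -> r \is a Num.int.
Proof.
case=> p p_monic.
have -> : map_poly (intr : int -> K) p =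
    map_poly (in_alg K) (map_poly (intr : int -> rat) p).
  rewrite -map_poly_comp; apply: eq_map_poly => z.
  by rewrite /= -[RHS]/(in_alg K z%:~R) rmorph_int.
rewrite fmorph_root -(fmorph_root (ratr : {rmorphism rat -> algC})) => pr.
have : ratr r \in Aint.
  apply: root_monic_Aint pr _ _; first by rewrite !monic_map.
  rewrite -map_poly_comp; apply/polyOverP => i; rewrite coef_map /=.
  by rewrite ratr_int intr_int.
move=> /(Cint_rat_Aint (Crat_rat r))/intrP[z].
by rewrite -(ratr_int algC) => /fmorph_inj ->; rewrite intr_int.
Qed.

Lemma integral_fmorph (K L : fieldType) (f : {rmorphism K -> L}) (z : K) :
  integralOver (intr : int -> K) z -> integralOver (intr : int -> L) (f z).
Proof.
case=> p p_monic pz; exists p => //.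
have -> : map_poly (intr : int -> L) p = map_poly f (map_poly intr p).
  rewrite -map_poly_comp; apply: eq_map_poly => a.
  by rewrite /= -[RHS]/(f a%:~R) rmorph_int.
by rewrite fmorph_root.
Qed.

(** For (A + B s) / 2 with s^2 = m, x and y are the coordinates on 1, (1 + s) / 2 or on 1, s.
    Squares are 0 or 1 modulo 4 and 4 does not divide m, so A and B have the same parity if m = 1
    modulo 4 and are both even otherwise. *)
Lemma half_int_parity (m A B c : int) : squarefree m ->
  A ^+ 2 - m * B ^+ 2 = 4 * c ->
  exists x y : int, if (m %% 4)%Z == 1 then A = 2 * x + y /\ B = y
                    else A = 2 * x /\ B = 2 * y.
Proof.
move=> m_sqf eq4.
have m4 : (m %% 4)%Z != 0.
  apply/negP => /eqP/(dvdz_mod0P (m := m))-m4.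
  by have := m_sqf 2 m4.
have [A' [e [A_def e01]]] : exists A' e : int, A = 2 * A' + e /\ (e = 0 \/ e = 1).
  by exists (A %/ 2)%Z, (A %% 2)%Z; lia.
have [B' [d [B_def d01]]] : exists B' d : int, B = 2 * B' + d /\ (d = 0 \/ d = 1).
  by exists (B %/ 2)%Z, (B %% 2)%Z; lia.
have [q [r [m_def r123]]] : exists q r : int,
    m = 4 * q + r /\ (r = 1 \/ r = 2 \/ r = 3).
  by exists (m %/ 4)%Z, (m %% 4)%Z; lia.
have -> : ((m %% 4)%Z == 1) = (r == 1) by lia.
move: eq4; rewrite A_def B_def m_def.
case: r123 => [->|[->|->]]; case: e01 => ->; case: d01 => -> eq4 /=;
  first [ by exists (A' - B'), (2 * B'); lia
        | by exists (A' - B'), (2 * B' + 1); lia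
        | by exists A', B'; lia | by exfalso; lia].
Qed.

(** * The quadratic field: conjugation, norm and integral basis *)

Section QuadraticField.

Variables (m : int) (K : splittingFieldType rat) (s : K).
Hypotheses (m_neq1 : m != 1) (m_sqf : squarefree m).
Hypotheses (s_sqrt : s ^+ 2 = m%:~R) (K_gen : <<1; s>>%VS = {:K}%VS).

Lemma in_alg_sqrt_eq0 (a b : rat) : a%:A + b *: s = 0 -> a = 0 /\ b = 0.
Proof.
move=> ab0; have [b0|b_neq0] := eqVneq b 0.
  split=> //; move: ab0; rewrite b0 scale0r addr0 => /eqP.
  by rewrite scaler_eq0 oner_eq0 orbF => /eqP.
have s_def : s = (- (b^-1 * a))%:A.
  rewrite -[LHS]scale1r -(mulVf b_neq0) -scalerA.
  by rewrite -[b *: s](addKr a%:A) ab0 addr0 scalerN scalerA scaleNr.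
have /negP[] := squarefree_not_rat_square (- (b^-1 * a)) m_sqf m_neq1.
apply/eqP/(fmorph_inj (in_alg K)).
by rewrite rmorphXn rmorph_int -s_sqrt s_def.
Qed.

Lemma sqrt_coord (z : K) : exists a b : rat, z = a%:A + b *: s.
Proof.
have : z \in <<1; s>>%VS by rewrite K_gen memvf.
case/Fadjoin1_polyP=> p ->; elim/poly_ind: p => [|p c [a [b IHp]]].
  by exists 0, 0; rewrite rmorph0 horner0 !scale0r addr0.
(* (a + b s) s + c = (b m + c) + a s. *)
exists (b * m%:~R + c), a.
rewrite rmorphD rmorphM /= map_polyX map_polyC hornerMXaddC IHp.
rewrite mulrDl mulr_algl -scalerAl -expr2 s_sqrt scalerDl -addrA addrC.
congr (_ + _ + _).
by rewrite -scalerA -[m%:~R%:A]/(in_alg K m%:~R) rmorph_int.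
Qed.

(** An automorphism is determined by its value at s, which is s or -s. As s is irrational, the
    degree exceeds 1 and the Galois group consists of the identity and f. *)
Lemma exists_conj : exists2 f : {rmorphism K -> K},
  (forall a b : rat, f (a%:A + b *: s) = a%:A - b *: s) &
  (forall z, galNorm 1 {:K} z = z * f z).
Proof.
have galK : galois 1 {:K}.
  rewrite /galois subvf normalFieldf andbT; apply/separableP => y _.
  apply: pcharf0_separable => p.
  by rewrite (fmorph_pchar (in_alg K)) pchar_num.
pose G := 'Gal({:K} / 1)%g.
have linG (g : gal_of {:K}) a b : g (a%:A + b *: s) = a%:A + b *: g s.
  by rewrite linearD !linearZ /= rmorph1.
have gal_s (g : gal_of {:K}) : g s = s \/ g s = - s.
  apply/pred2P; rewrite -eqf_sqr -rmorphXn s_sqrt.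
  by rewrite rmorph_int.
have eqG (g h : gal_of {:K}) : g s = h s -> g = h.
  move=> eq_gh; apply/eqP/gal_eqP => z _.
  by have [a [b ->]] := sqrt_coord z; rewrite !linG eq_gh.
have [g gG g_neq1] : exists2 g, g \in G & g != 1%g.
  apply/trivgPn; rewrite -cardG_gt1 -(galois_dim galK) dimv1 divn1.
  rewrite ltnNge; apply/negP => dim_le1.
  have : (1%VS == {:K}%VS) by rewrite eqEdim subvf dimv1.
  move/eqP=> K1; have : s \in 1%VS by rewrite K1 memvf.
  case/vlineP=> a sa; have [] := @in_alg_sqrt_eq0 (- a) 1.
    by rewrite scale1r sa scaleNr addNr.
  by [].
have gs : g s = - s.
  case: (gal_s g) => // gs; case/eqP: g_neq1; apply: eqG.
  by rewrite gs gal_id.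
exists g => [a b|z]; first by rewrite [LHS](linG g a b) gs scalerN.
have G_def : G = [set 1%g; g].
  apply/setP=> h; rewrite !inE; apply/idP/pred2P=> [_|[]->//].
  case: (gal_s h) => hs; [left|right]; apply: eqG; rewrite hs ?gal_id //.
by rewrite /galNorm -/G G_def big_setU1 ?inE 1?eq_sym // big_set1 gal_id.
Qed.

Lemma galNorm_sqrt (a b : rat) :
  galNorm 1 {:K} (a%:A + b *: s) = (a ^+ 2 - m%:~R * b ^+ 2)%:A.
Proof.
have [f fE ->] := exists_conj; rewrite fE.
rewrite mulrC -subr_sqr !exprZn expr1n s_sqrt scalerBl.
by rewrite -(rmorph_int (in_alg K)) /= scalerA mulrC.
Qed.

(** The trace 2a = A and the norm c are integral and rational, hence integers. Then (2b)^2 m = A^2 -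
    4c is an integer, and 2b is one because m is squarefree. *)
Lemma integral_sqrt_coord (a b : rat) :
  integralOver (intr : int -> K) (a%:A + b *: s) ->
  exists A B c : int,
    [/\ 2 * a = A%:~R, 2 * b = B%:~R & A ^+ 2 - m * B ^+ 2 = 4 * c].
Proof.
move=> z_int; have [f fE normE] := exists_conj.
have fz_int := integral_fmorph f z_int.
have := integral_add (RtoK := intr : {rmorphism int -> K}) z_int fz_int.
rewrite fE addrACA subrr addr0 -scalerDl => /rat_integral_int/intrP[A A_def].
have := integral_mul (RtoK := intr : {rmorphism int -> K}) z_int fz_int.
rewrite -normE galNorm_sqrt => /rat_integral_int/intrP[c c_def].
have /intrP[B B_def] : 2 * b \is a Num.int.
  apply: (rat_int_of_sqr_mul m_sqf).
  have -> : (2 * b) ^+ 2 * m%:~R = (A ^+ 2 - 4 * c)%:~R.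
    by rewrite !(rmorphB, rmorphM, rmorphXn) /= -A_def -c_def; ring.
  exact: intr_int.
exists A, B, c; split=> //; first by rewrite -A_def; ring.
apply: (@intr_inj rat); rewrite !(rmorphB, rmorphM, rmorphXn) /=.
rewrite -c_def -A_def -B_def.
by ring.
Qed.

Lemma integral_basis : exists (t n : int) (w : K),
  [/\ t ^+ 2 - 4 * n = disc m,
      w \in @integral_pred K /\ w ^+ 2 = t%:~R * w - n%:~R,
      forall x y : rat, galNorm 1 {:K} (x%:A + y *: w) = (qnorm t n x y)%:A,
      forall x y : rat, x%:A + y *: w = 0 -> x = 0 /\ y = 0
    & (forall z : K, exists x y : rat, z = x%:A + y *: w) /\
      forall x y : rat, x%:A + y *: w \in @integral_pred K ->
        x \is a Num.int /\ y \is a Num.int].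
Proof.
(* Both congruence cases are treated at once by w = t/2 + f s: w = (1 + s) / 2 if m = 1 modulo 4,
   and w = s otherwise. *)
have [t [n [f [f_neq0 disc_def f_def coord_int]]]] : exists (t n : int) (f : rat),
    [/\ f != 0, t ^+ 2 - 4 * n = disc m, 4 * f ^+ 2 * m%:~R = (disc m)%:~R
      & forall x y : rat,
          integralOver (intr : int -> K) ((x + y * (t%:~R / 2))%:A + (y * f) *: s) ->
          x \is a Num.int /\ y \is a Num.int].
  rewrite /disc; case: ifP => m4.
    exists 1, ((1 - m) %/ 4)%Z, 2^-1; split=> //; first by lia.
      by field.
    move=> x y /integral_sqrt_coord[A [B [c [A_def B_def]]]].
    case/(half_int_parity m_sqf) => x' [y']; rewrite m4 => -[A_eq B_eq].
    have y_eq : y = y'%:~R by rewrite -B_eq -B_def; field.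
    have -> : x = x'%:~R.
      have : 2 * (x + y * (1 / 2)) = 2 * x'%:~R + y.
        by rewrite A_def A_eq y_eq rmorphD rmorphM.
      by lra.
    by rewrite y_eq !intr_int.
  exists 0, (- m), 1; split=> //; first by ring.
    by rewrite rmorphM expr1n mulr1.
  move=> x y; rewrite mul0r mulr0 addr0 mulr1.
  case/integral_sqrt_coord=> A [B [c [A_def B_def]]].
  case/(half_int_parity m_sqf) => x' [y']; rewrite m4 => -[A_eq B_eq].
  have -> : x = x'%:~R by move: A_def; rewrite A_eq rmorphM /=; lra.
  have -> : y = y'%:~R by move: B_def; rewrite B_eq rmorphM /=; lra.
  by rewrite !intr_int.
pose w : K := (t%:~R / 2)%:A + f *: s.
have wE x y : x%:A + y *: w = (x + y * (t%:~R / 2))%:A + (y * f) *: s.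
  by rewrite /w scalerDr !scalerA addrA -scalerDl.
have n_def : n%:~R = (t%:~R / 2) ^+ 2 - m%:~R * f ^+ 2 :> rat.
  have : t%:~R ^+ 2 - 4 * n%:~R = 4 * f ^+ 2 * m%:~R :> rat.
    by rewrite f_def -disc_def !(rmorphB, rmorphM, rmorphXn).
  by move=> eq_disc; lra.
have w2 : w ^+ 2 = t%:~R * w - n%:~R.
  pose phi : {rmorphism rat -> K} := in_alg K.
  have w_phi : w = phi (t%:~R / 2) + phi f * s by rewrite /w -[f *: s]mulr_algl.
  have t_phi : t%:~R = phi (t%:~R / 2) + phi (t%:~R / 2).
    by rewrite -rmorphD -(rmorph_int phi); congr (phi _); field.
  have n_phi : n%:~R = phi (t%:~R / 2) ^+ 2 - s ^+ 2 * phi f ^+ 2.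
    by rewrite s_sqrt -!(rmorph_int phi) n_def rmorphB rmorphM !rmorphXn.
  by rewrite t_phi n_phi w_phi; ring.
exists t, n, w; split=> //.
- split=> //; apply/asboolP; exists (('X - t%:P) * 'X + n%:P).
    rewrite monicE lead_coefDl ?lead_coefMX ?lead_coefXsubC //.
    by rewrite size_mulX ?polyXsubC_eq0 // size_XsubC size_polyC; case: (n != 0).
  apply/rootP; rewrite rmorphD rmorphM rmorphB /= map_polyX !map_polyC /=.
  rewrite !hornerE mulrBl -expr2 w2; ring.
- move=> x y; rewrite wE galNorm_sqrt; congr _%:A.
  by rewrite /qnorm n_def; field.
- move=> x y; rewrite wE => /in_alg_sqrt_eq0[x0 /eqP].
  rewrite mulf_eq0 (negPf f_neq0) orbF => /eqP y0.
  by move: x0; rewrite y0 mul0r addr0.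
- split=> [z|x y /asboolP]; last by rewrite wE; apply: coord_int.
  have [a [b ->]] := sqrt_coord z.
  exists (a - b / f * (t%:~R / 2)), (b / f).
  by rewrite wE subrK divfK.
Qed.

End QuadraticField.

(** * From the hypothesis on primes to principal ideals *)

Lemma ringOfIntegers_idomain (K : fieldType) :
  GRing.integral_domain_axiom (ringOfIntegers K).
Proof.
move=> x y /(congr1 (@int_val K)) xy0.
have /eqP : val x * val y = 0 :> K by rewrite -rmorphM; exact: xy0.
rewrite mulf_eq0.
by case/orP=> /eqP z0; apply/orP; [left|right]; apply/eqP/val_inj.
Qed.

(** Completing the square gives (t - 2u)^2 = D + 4kp. For odd p, D is thus a square modulo p; for p
    = 2 and D odd, D is an odd square modulo 8, that is 1. *)
Lemma kronecker_neqN1 (D t n u : int) (p : nat) : prime p ->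
  t ^+ 2 - 4 * n = D -> (p%:Z %| u ^+ 2 - t * u + n)%Z -> kronecker D p <> -1.
Proof.
move=> p_pr D_def /dvdzP[k k_def]; rewrite /kronecker.
case: ifP => // pD; case: ifP => [/eqP p2|_].
  have D_sqr : D = (t - 2 * u) ^+ 2 - 8 * k.
    by move: k_def; rewrite p2 -D_def => k_def; lia.
  have t_odd : ((t - 2 * u) %% 2)%Z = 1.
    apply/eqP; apply: contraFT pD => t_even; rewrite p2 D_sqr.
    have -> : t - 2 * u = 2 * ((t - 2 * u) %/ 2)%Z by lia.
    by apply/dvdzP; exists (2 * ((t - 2 * u) %/ 2)%Z ^+ 2 - 4 * k); ring.
  suff -> : (D %% 8)%Z == 1 by [].
  move: D_sqr t_odd; move: (t - 2 * u) => v -> v_odd.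
  have [c [d [v_def d01]]] : exists c d : int, v = 4 * c + d /\ (d = 1 \/ d = 3).
    by exists (v %/ 4)%Z, (v %% 4)%Z; lia.
  by rewrite v_def; case: d01 => ->; lia.
suff -> : [exists x : 'F_p, x ^+ 2 == D%:~R] by [].
apply/existsP; exists (t - 2 * u)%:~R; apply/eqP.
rewrite -rmorphXn.
have -> : (t - 2 * u) ^+ 2 = D + 4 * k * p%:Z by rewrite -mulrA -k_def -D_def; ring.
rewrite rmorphD rmorphM /= -pmulrn pchar_Fp_0 // mulr0 addr0.
by [].
Qed.

Lemma le_mu (m : int) (p : nat) :
  (if disc m < 0 then 3 * p%:Z ^+ 2 <= - disc m else 5 * p%:Z ^+ 2 <= disc m) ->
  p%:R <= mu m.
Proof.
have -> : (disc m < 0) = (m < 0) by rewrite /disc; case: ifP; lia.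
suff le_sqrt (c : nat) (d : int) : (0 < c)%N -> c%:Z * p%:Z ^+ 2 <= d ->
    p%:R <= Num.sqrt (d%:~R / c%:R) :> algR.
  by rewrite /mu; case: ifP => _; exact: le_sqrt.
move=> c_gt0 le_d; rewrite -[p%:R]ger0_norm // -sqrtr_sqr ler_wsqrtr //.
rewrite ler_pdivlMr ?ltr0n // mulrC; move: le_d; rewrite -(ler_int algR).
by rewrite rmorphM rmorphXn /= -!pmulrn.
Qed.

Theorem theorem2 (m : int) (K : splittingFieldType rat) (s : K)
    (m_neq1 : m != 1) (m_sqf : squarefree m)
    (s_sqrt : s ^+ 2 = m%:~R) (K_gen : <<1; s>>%VS = {:K}%VS)
    (hnorm : forall p : nat, prime p -> (2 <= p)%N -> p%:R <= mu m ->
       kronecker (disc m) p <> -1 ->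
       exists (pi : ringOfIntegers K) (n : rat),
         galNorm 1 {:K} (int_val pi) = n%:A /\ p%:R = `|n|) :
  is_PID (ringOfIntegers K).
Proof.
split=> [|I [I0 ID IM]]; first exact: ringOfIntegers_idomain.
have [t [n [w [disc_def [w_int w2] normE w_free [w_gen w_coord]]]]] :=
  integral_basis m_neq1 m_sqf s_sqrt K_gen.
pose valK : {rmorphism ringOfIntegers K -> K} := val.
have int_K (z : K) : z \in @integral_pred K ->
    exists r : ringOfIntegers K, valK r = z.
  by move=> z_int; exists (RingOfIntegers z_int).
have [wO wO_def] := int_K w w_int.
have valM x y : valK (x * y) = valK x * valK y by exact: rmorphM.
have valD x y : valK (x + y) = valK x + valK y by exact: rmorphD.
(* Norms from the ring of integers are integers, as the coordinates on 1, w are. *)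
have normO (r : ringOfIntegers K) : exists k : nat, exists2 q : rat,
    galNorm 1 {:K} (valK r) = q%:A & `|q| = k%:R.
  have [x [y r_def]] := w_gen (valK r).
  have /w_coord[/intrP[a a_def] /intrP[b b_def]] :
      x%:A + y *: w \in @integral_pred K by rewrite -r_def; apply: valP.
  pose q := a ^+ 2 + t * a * b + n * b ^+ 2.
  exists `|q|%N, q%:~R; last by rewrite pmulrn abszE intr_norm.
  by rewrite r_def normE a_def b_def /qnorm !(rmorphD, rmorphM, rmorphXn).
pose phi : {rmorphism rat -> K} := in_alg K.
have linE x y : x%:A + y *: w = phi x + phi y * w by rewrite -[y *: w]mulr_algl.
have in_algI : injective (fun q : rat => q%:A : K) := fmorph_inj (in_alg K).
have [I_trivial|] := pselect (forall x, I x -> x = 0).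
  exists 0 => x; split=> [/I_trivial-> | [r ->]]; last by rewrite mulr0.
  by exists 0; rewrite mulr0.
move=> /existsNP[h0 /not_implyP[Ih0 /eqP h0_neq0]].
(* The absolute norms of nonzero elements of I; g attains the least one. *)
pose P (k : nat) := `[< exists g, [/\ I g, g != 0 & exists2 q : rat,
    galNorm 1 {:K} (valK g) = q%:A & `|q| = k%:R] >].
have exP : exists k, P k.
  by have [k kP] := normO h0; exists k; apply/asboolP; exists h0.
case: (ex_minnP exP) => N /asboolP[g [Ig g_neq0 [Ng Ng_def NgE]]] N_min.
have vg_neq0 : valK g != 0.
  by apply: contraNneq g_neq0 => g0; apply/eqP/val_inj; rewrite -/valK g0 rmorph0.
have Ng_gt0 : 0 < `|Ng|.
  rewrite normr_gt0; apply: contraNneq vg_neq0 => Ng0.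
  by rewrite -(galNorm_eq0 1 {:K}) Ng_def Ng0 scale0r.
(* The coordinates of the elements of g^-1 I. *)
pose J x y := exists2 i, I i & valK i = (x%:A + y *: w) * valK g.
have J_int x y : J x y -> x \is a Num.int /\ y \is a Num.int.
  apply: (@overmodule_trivial t n J).
  - move=> x1 y1 x2 y2 [i Ii i_def] [j Ij j_def]; exists (i + j); first exact: ID.
    by rewrite valD i_def j_def -mulrDl !scalerDl addrACA.
  - move=> a x1 y1 [i Ii i_def]; exists (a%:~R * i); first exact: IM.
    rewrite valM i_def rmorph_int mulrA; congr (_ * _).
    by rewrite mulrDr -!scalerA !(mulrzl, scaler_int, mulrzr).
  - move=> x1 y1 [i Ii i_def]; exists (wO * i); first exact: IM.
    rewrite valM i_def wO_def mulrA; congr (_ * _).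
    rewrite !linE rmorphD !rmorphM rmorphN !(rmorph_int phi).
    transitivity (phi x1 * w + phi y1 * w ^+ 2); first by ring.
    by rewrite w2; ring.
  - by exists g => //; rewrite scale0r addr0 scale1r mul1r.
  - move=> x1 y1 [i Ii i_def] xy_neq0.
    have i_neq0 : i != 0.
      apply: contraTneq xy_neq0 => i0; move/esym/eqP: i_def.
      rewrite i0 rmorph0 mulf_eq0 (negPf vg_neq0) orbF => /eqP/w_free[-> ->].
      by rewrite eqxx.
    have [k [q q_def qk]] := normO i.
    (* Minimality gives |N i| >= |N g|, while i = (x1 + y1 w) g and the norm is multiplicative. *)
    have := N_min k; rewrite /P; case: asboolP => [_ /(_ isT)|[]]; last first.
      by exists i; split=> //; exists q.
    rewrite -(ler_nat rat) -NgE -qk.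
    have -> : q = qnorm t n x1 y1 * Ng.
      apply: in_algI; rewrite -q_def i_def galNormM normE Ng_def.
      by rewrite -scalerAl mul1r scalerA.
    by rewrite normrM ler_pMl.
  - move=> p p_pr; rewrite disc_def => /le_mu p_mu [u u_dvd].
    have p_kron := kronecker_neqN1 p_pr disc_def u_dvd.
    have [pi [q [q_def qp]]] := hnorm p p_pr (prime_gt1 p_pr) p_mu p_kron.
    have [x1 [y1 pi_def]] := w_gen (int_val pi).
    have /w_coord[/intrP[a a_def] /intrP[b b_def]] :
      x1%:A + y1 *: w \in @integral_pred K by rewrite -pi_def; apply: (valP pi).
    exists a, b; rewrite qp -a_def -b_def; congr `|_|.
    by apply: in_algI; rewrite -normE -pi_def q_def.
exists g => h; split=> [Ih|[r ->]]; last exact: IM.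
(* h / g lies in g^-1 I, so its coordinates are integers and h is a multiple of g. *)
have [x [y xy_def]] := w_gen (valK h / valK g).
have [/intrP[a a_def] /intrP[b b_def]] : x \is a Num.int /\ y \is a Num.int.
  by apply: J_int; exists h => //; rewrite -xy_def divfK.
exists (a%:~R + b%:~R * wO); apply: val_inj; rewrite -/valK valM.
rewrite -[valK h](divfK vg_neq0) xy_def a_def b_def linE valD valM.
by rewrite !rmorph_int wO_def.
Qed.
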